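(* Let $s$ and $t$ be two processes. If $s\approx_{\mathcal{O}}t$ then $s\approx_{\mathcal{T}}t$.
   Context: Fix a finite set of actions $\mathcal{A}$. A probabilistic transition system (PTS) is a tuple $(S_n,S_p,\rightarrow,\dashrightarrow)$ where $S_n,S_p$ are finite disjoint sets of nondeterministic and probabilistic states; $\rightarrow\ \subseteq S_n\times\mathcal{A}\times(S_n\cup S_p)$ is an action transition relation such that $(s,a,t),(s,a,t')\in\rightarrow$ implies $t=t'$; and $\dashrightarrow\ \subseteq S_p\times(0,1]\times S_n$ is a probabilistic transition relation with $\sum_{(s,\pi,t)\in\dashrightarrow}\pi=1$ for every $s\in S_p$. A state with no outgoing transitions belongs to $S_n$. Write $s\xrightarrow{a}t$ and $s\overset{\pi}{\dashrightarrow}t$. A process is a state together with all states reachable from it and the transitions between them. For $s\in S_n$, its menu is $I(s)=\{a: s\xrightarrow{a}t \text{ for some } t\}$, and $s_a$ denotes the state with $s\xrightarrow{a}s_a$. Probabilistic ready trace equivalence. Given a process $s$, a set $M\subseteq\mathcal{A}$ and $a\in M$ such that $I(s)=M$ if $s\in S_n$, or otherwise there is $s\dashrightarrow s'$ with $I(s')=M$, the process $s_{(M,a)}$ is: if $s\in S_n$, the process rooted at $s'$ with $s\xrightarrow{a}s'$; if $s\in S_p$, a new root state with, letting $\pi=\sum\{\pi_i : s\overset{\pi_i}{\dashrightarrow}s_i,\ I(s_i)=M\}$, for every $s_i'$ with $s\overset{\pi_i}{\dashrightarrow}s_i\xrightarrow{a}s_i'$ and $I(s_i)=M$: an edge with probability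 $\pi_i/\pi$ to $s_i'$ if $s_i'$ has no probabilistic transitions, and for every $s_i'\overset{\rho}{\dashrightarrow}s_i''$ an edge with probability $\pi_i\rho/\pi$ to $s_i''$. A ready trace of length $n$ is $(M_1,a_1,\dots,M_{n-1},a_{n-1},M_n)$ with $M_i\subseteq\mathcal{A}$, $a_i\in M_i$. Define $P^1_s(M)=\sum_{s\overset{\pi}{\dashrightarrow}s'}\pi P^1_{s'}(M)$ if $s\in S_p$, $=1$ if $s\in S_n$ and $I(s)=M$, $=0$ otherwise; for $n>1$, if $P^1_s(M_1)>0$, $P^2_s(M_2\mid M_1,a_1)=P^1_{s_{(M_1,a_1)}}(M_2)$ and $P^n_s(M_n\mid M_1,a_1,\dots,a_{n-1})=P^{n-1}_{s_{(M_1,a_1)}}(M_n\mid M_2,a_2,\dots,a_{n-1})$, and these are undefined if $P^1_s(M_1)=0$. Then $s\approx_{\mathcal{O}}\bar s$ iff $P^1_s(M)=P^1_{\bar s}(M)$ for all $M$, and for all $n>1$ and all ready traces the values $P^n_s(\cdot\mid\cdot)$ and $P^n_{\bar s}(\cdot\mid\cdot)$ are defined for the same ready traces and equal when defined. Testing equivalence. Let $\mathcal{R}$ be the set of rational functions generated by $\varphi::=\alpha\mid a\mid\varphi+\varphi\mid\varphi\cdot\varphi\mid\varphi/\varphi$ with $\alpha\ge0$ a scalar and $a\in\mathcal{A}$ a variable; variables range over $(0,\infty)$, and two elements of $\mathcal{R}$ are equal iff they are equal as functions on $(0,\infty)^{|\mathcal{A}|}$. A test is a finite process (in a PTS over actions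 $\mathcal{A}\cup\{\omega\}$, $\omega\notin\mathcal{A}$) in which some states may have $\omega$-transitions. For a process $s$ and test $T$, $\mathsf{Res}(s,T)\in\mathcal{R}$ is defined by: $\mathsf{Res}(s,T)=1$ if $T\xrightarrow{\omega}$; otherwise, if $s\in S_p$, $\mathsf{Res}(s,T)=\sum_{s\overset{\pi_i}{\dashrightarrow}s_i}\pi_i\mathsf{Res}(s_i,T)$; otherwise, if $T$ is probabilistic, $\mathsf{Res}(s,T)=\sum_{T\overset{\pi_i}{\dashrightarrow}T_i}\pi_i\mathsf{Res}(s,T_i)$; otherwise $\mathsf{Res}(s,T)=\sum_{a\in K}\frac{a}{\sum_{b\in K}b}\mathsf{Res}(s_a,T_a)$ with $K=I(s)\cap I(T)$ (an empty sum being $0$). Processes $s,\bar s$ are testing equivalent, $s\approx_{\mathcal{T}}\bar s$, iff $\mathsf{Res}(s,T)$ and $\mathsf{Res}(\bar s,T)$ are equal functions for every test $T$. *)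

(* Defs.v *)
From mathcomp Require Import all_boot all_order all_algebra.
From mathcomp Require Import boolp reals interval_inference.
Set Implicit Arguments.
Unset Strict Implicit.
Unset Printing Implicit Defensive.
Import Order.TTheory GRing.Theory Num.Theory.
Local Open Scope ring_scope.

(* Raw transition structures. Action determinism is built in: [step x a] is the
   a-successor of x, if any. [dist q] lists the pairs (pi, y) with q -pi-> y.
   It is a list so that the fresh root built by [after] below may
   carry several identical edges, whose weights have to be added. *)
Record pts_data (R : realType) (Act : finType) := PtsData {
  nd : finType;
  pr : finType;
  step : nd -> Act -> option (nd + pr);
  dist : pr -> seq (R * nd) }.

Definition state (R : realType) (Act : finType) (X : pts_data R Act) : finType :=
  (nd X + pr X)%type.

(* [uniq]: in a PTS the probabilistic transitions form a set of triples. *)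
Definition is_pts (R : realType) (Act : finType) (X : pts_data R Act) : Prop :=
  forall q : pr X,
    [/\ uniq (dist q),
        {in dist q, forall e, 0 < e.1 <= 1} &
        \sum_(e <- dist q) e.1 = 1].

Record process (R : realType) (Act : finType) := Process {
  sys : pts_data R Act;
  init : state sys }.

Definition menu (R : realType) (Act : finType) (X : pts_data R Act) (x : nd X) :
    {set Act} :=
  [set a | step x a].

Section ReadyTraces.
Variables (R : realType) (Act : finType).
Implicit Types (X : pts_data R Act) (p : process R Act) (M : {set Act}).

(* X extended with a new probabilistic state, [None], with edges [es]. *)
Definition adjoin X (es : seq (R * nd X)) : pts_data R Act :=
  @PtsData R Act (nd X) (option (pr X))
    (fun x a => match step x a with
                | Some (inl y) => Some (inl y)
                | Some (inr q) => Some (inr (Some q))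
                | None => None
                end)
    (fun o => if o is Some q then dist q else es).

(* The edges leaving the new root because of an edge to x of rescaled weight w. *)
Definition after_edges1 X (w : R) (x : nd X) (a : Act) : seq (R * nd X) :=
  match step x a with
  | Some (inl y) => [:: (w, y)]
  | Some (inr q) => [seq (w * e.1, e.2) | e <- dist q]
  | None => [::]
  end.

Definition after_edges X (q : pr X) M (a : Act) : seq (R * nd X) :=
  let hits := [seq e <- dist q | menu e.2 == M] in
  let w := \sum_(e <- hits) e.1 in
  flatten [seq after_edges1 (e.1 / w) e.2 a | e <- hits].

(* The process s_(M,a). It is only meaningful when a \in M and M is the menu of
   s, or of some probabilistic successor of s; other values are irrelevant. *)
Definition after p M (a : Act) : process R Act :=
  match init p with
  | inl x => if step x a is Some y then Process y else p
  | inr q => @Process R Act (adjoin (after_edges q M a)) (inr None)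
  end.

Definition menu_prob p M : R :=
  match init p with
  | inl x => (menu x == M)%:R
  | inr q => \sum_(e <- dist q) e.1 * (menu e.2 == M)%:R
  end.

(* [ready_prob [:: (M1, a1); ...; (Mn-1, an-1)] Mn p] is
   P^n_p(Mn | M1, a1, ..., Mn-1, an-1), and P^1_p(M1) when n = 1;
   [None] stands for "undefined". *)
Fixpoint ready_prob (l : seq ({set Act} * Act)) M p : option R :=
  match l with
  | [::] => Some (menu_prob p M)
  | (M1, a1) :: l' =>
      if 0 < menu_prob p M1 then ready_prob l' M (after p M1 a1) else None
  end.

Definition ready_trace_equiv p p' : Prop :=
  forall (l : seq ({set Act} * Act)) M,
    (forall Ma, Ma \in l -> Ma.2 \in Ma.1) -> ready_prob l M p = ready_prob l M p'.

End ReadyTraces.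

Section RationalFunctions.
Variables (R : realType) (Act : finType).

Definition env : Type := Act -> {posnum R}.

Inductive ratfun : (env -> R) -> Prop :=
| ratfun_const (c : R) of 0 <= c : ratfun (fun=> c)
| ratfun_var (a : Act) : ratfun (fun v => (v a)%:num)
| ratfun_add f g of ratfun f & ratfun g : ratfun (fun v => f v + g v)
| ratfun_mul f g of ratfun f & ratfun g : ratfun (fun v => f v * g v)
| ratfun_div f g of ratfun f & ratfun g & (forall v, g v != 0) :
    ratfun (fun v => f v / g v).

Lemma ratfun_sum (I : eqType) (r : seq I) (P : pred I) (F : I -> env -> R) :
  (forall i, i \in r -> P i -> ratfun (F i)) ->
  ratfun (fun v => \sum_(i <- r | P i) F i v).
Proof.
elim: r => [|i r IHr] rF.
  rewrite (_ : (fun _ => _) = fun=> 0); first exact: ratfun_const.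
  by apply/funext => v; rewrite big_nil.
have /IHr rr j : j \in r -> P j -> ratfun (F j).
  by move=> jr; apply: rF; rewrite inE jr orbT.
case Pi: (P i).
  rewrite (_ : (fun _ => _) = fun v => F i v + \sum_(j <- r | P j) F j v).
    by apply: ratfun_add rr; apply: rF => //; rewrite mem_head.
  by apply/funext => v; rewrite big_cons Pi.
rewrite (_ : (fun _ => _) = fun v => \sum_(j <- r | P j) F j v) //.
by apply/funext => v; rewrite big_cons Pi.
Qed.

End RationalFunctions.

Section Testing.
Variables (R : realType) (Act : finType).

(* Tests are processes over [option Act], the action omega being [None]. *)

Definition succ (A : finType) (X : pts_data R A) : rel (state X) :=
  fun x y => match x, y with
             | inl n, _ => [exists a, step n a == Some y]
             | inr q, inl m => m \in [seq e.2 | e <- dist q]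
             | inr _, inr _ => false
             end.

(* A finite process has no infinite run; as branching is finite, this means that
   its runs have bounded length. *)
Definition finite_process (A : finType) (X : pts_data R A) (x : state X) : Prop :=
  exists n : nat, forall r : seq (state X), path (@succ A X) x r -> (size r <= n)%N.

Definition has_omega (Y : pts_data R (option Act)) (T : state Y) : bool :=
  if T is inl y then step y None else false.

Definition res_body (X : pts_data R Act) (Y : pts_data R (option Act))
    (res : state X -> state Y -> env R Act -> R)
    (s : state X) (T : state Y) (v : env R Act) : R :=
  if has_omega T then 1 else
  match s, T with
  | inr q, _ => \sum_(e <- dist q) e.1 * res (inl e.2) T v
  | inl _, inr q => \sum_(e <- dist q) e.1 * res s (inl e.2) v
  | inl x, inl y =>
      let K := [set a | (a \in menu x) && (Some a \in menu y)] in
      \sum_(a in K) (v a)%:num / (\sum_(b in K) (v b)%:num) *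
        (if (step x a, step y (Some a)) is (Some s', Some T')
         then res s' T' v else 0)
  end.

(* The defining recursion of Res, unfolded often enough for the result not to
   depend on the starting function when T is finite: see [ResE]. *)
Definition Res (X : pts_data R Act) (Y : pts_data R (option Act)) :
    state X -> state Y -> env R Act -> R :=
  iter (2 * #|state Y|) (@res_body X Y) (fun _ _ _ => 0).

Definition testing_equiv (p p' : process R Act) : Prop :=
  forall T : process R (option Act),
    is_pts (sys T) -> finite_process (init T) ->
    Res (init p) (init T) =1 Res (init p') (init T).

Lemma finite_process_succ (A : finType) (X : pts_data R A) (x y : state X) :
  succ x y -> finite_process x -> finite_process y.
Proof.
move=> xy [n xn]; exists n => r yr.
by apply: ltnW; apply: (xn (y :: r)); rewrite /= xy.
Qed.

Lemma finite_process_lt_card (A : finType) (X : pts_data R A) (x : state X) r :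
  finite_process x -> path (@succ A X) x r -> (size r < #|state X|)%N.
Proof.
move=> fx xr; suff /card_uniqP cxr : uniq (x :: r).
  by have := max_card (mem (x :: r)); rewrite cxr.
elim: r x fx xr => [//|y r IHr] x fx /= /andP[xy yr].
have := IHr _ (finite_process_succ xy fx) yr; rewrite /= => ->; rewrite andbT.
apply/negP => xr; have {xr} : x \in y :: r by [].
have : path (@succ A X) x (y :: r) by rewrite /= xy.
move=> + xr; case/path.splitP: xr => r1 r2; rewrite cat_path => /andP[xr1 _].
case: fx => n /(_ (flatten (nseq n.+1 (rcons r1 x)))).
have cyc k : path (@succ A X) x (flatten (nseq k (rcons r1 x))).
  by elim: k => //= k IHk; rewrite cat_path xr1 last_rcons.
move=> /(_ (cyc _)); rewrite size_flatten /shape map_nseq sumn_nseq size_rcons.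
by rewrite mulnS leqNgt addSn ltnS mulSn addnCA leq_addr.
Qed.

Lemma Res_stable (X : pts_data R Act) (Y : pts_data R (option Act))
    f g n (s : state X) (T : state Y) :
  (forall r, path (@succ _ Y) T r -> (2 * size r + (if s is inr _ then 2 else 1) <= n)%N) ->
  iter n (@res_body X Y) f s T = iter n (@res_body X Y) g s T.
Proof.
elim: n s T => [|n IHn] s T nT.
  by have := nT [::] isT; case: (s).
have suc T' : succ T T' -> forall s', 
    iter n (@res_body X Y) f s' T' = iter n (@res_body X Y) g s' T'.
  move=> TT' s'; apply: IHn => r T'r.
  have := nT (T' :: r); rewrite /= TT' => /(_ T'r).
  move=> h; rewrite -ltnS; apply: leq_trans h.
  by rewrite mulnS -addnS (addnC 2%N) -addnA leq_add2l; case: s'; case: (s).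
apply/funext => v; rewrite !iterS /res_body; case: has_omega => //.
case: s nT => [x|q] nT.
  case: T nT suc => [y|q] nT suc.
    apply: eq_bigr => a _; congr (_ * _).
    case: (step x a) => // s'; case E: (step y (Some a)) => [T'|//].
    by rewrite suc //=; apply/existsP; exists (Some a); rewrite E.
  rewrite big_seq [RHS]big_seq; apply: eq_bigr => e eq; rewrite suc //=.
  exact: map_f.
apply: eq_bigr => e _; rewrite IHn // => r /nT.
by rewrite addnS ltnS.
Qed.

Lemma ResE (X : pts_data R Act) (Y : pts_data R (option Act))
    (s : state X) (T : state Y) :
  finite_process T -> Res s T = res_body (@Res X Y) s T.
Proof.
move=> fT; rewrite -[RHS]/(iter _.+1 _ _ s T) iterSr; apply: Res_stable => r Tr.
apply: (@leq_trans (2 * (size r).+1)); last first.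
  by rewrite leq_mul2l /= (finite_process_lt_card fT).
by rewrite mulnS addnC leq_add2r; case: s.
Qed.

Lemma Res_ratfun (X : pts_data R Act) (Y : pts_data R (option Act))
    (s : state X) (T : state Y) :
  is_pts X -> is_pts Y -> ratfun (Res s T).
Proof.
move=> ptsX ptsY; rewrite /Res; elim: (2 * _)%N s T => [|n IHn] s T.
  exact: ratfun_const.
rewrite iterS /res_body; case: has_omega; first exact: ratfun_const.
case: s => [x|q]; last first.
  apply: (@ratfun_sum _ _ _ _ _ (fun e v => e.1 * _)) => e eq _.
  have [_ /(_ e eq)/andP[/ltW e0 _] _] := ptsX q.
  by apply: ratfun_mul => //; exact: ratfun_const.
case: T => [y|q]; last first.
  apply: (@ratfun_sum _ _ _ _ _ (fun e v => e.1 * _)) => e eq _.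
  have [_ /(_ e eq)/andP[/ltW e0 _] _] := ptsY q.
  by apply: ratfun_mul => //; exact: ratfun_const.
set K := [set a | _].
apply: (@ratfun_sum _ _ _ _ _ (fun a v => _ / _ * _)) => a _ aK.
apply: ratfun_mul; last first.
  by case: step => [s'|]; [case: step => [T'|]|] => //; exact: ratfun_const.
apply: ratfun_div; first exact: ratfun_var.
  by apply: (@ratfun_sum _ _ _ _ _ (fun b v => (v b)%:num)) => b _ _; exact: ratfun_var.
move=> v; rewrite gt_eqF // (bigD1 a) //= ltr_pwDl //.
by apply: sumr_ge0.
Qed.

End Testing.

(* Main.v *)
Require Import Defs.
From mathcomp Require Import all_boot all_order all_algebra.
From mathcomp Require Import reals.
From mathcomp Require Import interval_inference.

(** Replace a process by the weighted list of the nondeterministic states in which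
it may start. The unnormalized mass with which such a list performs a ready trace
(the product of the conditional probabilities along it) is linear in the list, and
ready trace equivalence amounts to equality of all these masses. By induction on
the test, the expected result of a list depends only on its masses: it is a sum
over menus [M] and actions [a] of a coefficient depending only on [M], [a] and
the test, times the expected result of the list conditioned on [(M, a)]. *)

Set Implicit Arguments.
Unset Strict Implicit.
Unset Printing Implicit Defensive.
Import Order.TTheory GRing.Theory Num.Theory.
Local Open Scope ring_scope.

(** * Weighted lists and their masses along ready traces *)

Section WeightedLists.
Variables (R : realType) (Act : finType).
Implicit Types (X : pts_data R Act) (p : process R Act) (M : {set Act}).
Implicit Types (l : seq ({set Act} * Act)).

Definition scale (I : Type) (c : R) (es : seq (R * I)) : seq (R * I) :=
  [seq (c * e.1, e.2) | e <- es].

Definition start X (w : R) (x : state X) : seq (R * nd X) :=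
  match x with
  | inl y => [:: (w, y)]
  | inr q => scale w (dist q)
  end.

(** Unlike in [after_edges], weights are not divided by the mass of [M]: conditioning is linear and
    makes sense even where that mass is 0. *)
Definition cond_edges X (es : seq (R * nd X)) M (a : Act) : seq (R * nd X) :=
  flatten [seq after_edges1 e.1 e.2 a | e <- es & menu e.2 == M].

Fixpoint trace_mass X l M (es : seq (R * nd X)) : R :=
  if l is (M1, a) :: l' then trace_mass l' M (cond_edges es M1 a)
  else \sum_(e <- es | menu e.2 == M) e.1.

(** A weakening of [is_pts] that survives [after], whose new root may carry repeated edges. *)
Definition nonneg_weights X : Prop :=
  forall q : pr X, {in dist q, forall e, 0 <= e.1}.

Lemma scale1 (I : Type) (es : seq (R * I)) : scale 1 es = es.
Proof. by rewrite /scale -[RHS]map_id; apply: eq_map => -[w x]; rewrite mul1r. Qed.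

Lemma after_edges1E X w (x : nd X) a :
  after_edges1 w x a = if step x a is Some y then start w y else [::].
Proof. by rewrite /after_edges1; case: step => [[]|]. Qed.

Lemma after_edges1_scale X c w (x : nd X) a :
  after_edges1 (c * w) x a = scale c (after_edges1 w x a).
Proof.
rewrite /after_edges1 /scale; case: step => [[y|q]|] //.
by rewrite -map_comp; apply: eq_map => e /=; rewrite mulrA.
Qed.

Lemma cond_edges_scale X c (es : seq (R * nd X)) M a :
  cond_edges (scale c es) M a = scale c (cond_edges es M a).
Proof.
rewrite /cond_edges /scale filter_map -map_comp map_flatten -map_comp.
by congr flatten; apply: eq_map => e /=; rewrite after_edges1_scale.
Qed.

Lemma trace_mass_scale X c l M (es : seq (R * nd X)) :
  trace_mass l M (scale c es) = c * trace_mass l M es.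
Proof.
elim: l es => [|[M1 a] l IHl] es /=; last by rewrite cond_edges_scale.
by rewrite /scale big_map mulr_sumr.
Qed.

Lemma menu_adjoin X es (x : nd X) : menu (x : nd (adjoin es)) = menu x.
Proof. by apply/setP => a; rewrite !inE /=; case: step => [[]|]. Qed.

(** No transition leads to the new root, so it never matters after the start. *)
Lemma trace_mass_adjoin X es l M (fs : seq (R * nd X)) :
  trace_mass (X := adjoin es) l M fs = trace_mass l M fs.
Proof.
elim: l fs => [|[M1 a] l IHl] fs /=.
  by apply: eq_bigl => e; rewrite menu_adjoin.
rewrite -IHl; congr trace_mass; rewrite /cond_edges.
under eq_filter do rewrite menu_adjoin.
congr flatten; apply: eq_map => e.
by rewrite /after_edges1 /=; case: step => [[]|].
Qed.

Lemma after_edges_scale X (q : pr X) M a :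
  after_edges q M a =
  scale (\sum_(e <- dist q | menu e.2 == M) e.1)^-1 (cond_edges (dist q) M a).
Proof.
rewrite /after_edges /cond_edges /scale map_flatten -map_comp big_filter.
congr flatten; apply: eq_map => e /=.
by rewrite mulrC after_edges1_scale.
Qed.

(** * Masses versus conditional probabilities *)

Lemma menu_probE p M : menu_prob p M = trace_mass [::] M (start 1 (init p)).
Proof.
rewrite /menu_prob /=; case: (init p) => [x|q] /=.
  by rewrite big_mkcond big_seq1 /=; case: eqP.
rewrite scale1 [RHS]big_mkcond; apply: eq_bigr => e _.
by case: eqP => _; rewrite ?mulr1 ?mulr0.
Qed.

Lemma menu_prob_ge0 p M : nonneg_weights (sys p) -> 0 <= menu_prob p M.
Proof.
move=> p0; rewrite /menu_prob; case: (init p) => [x|q]; first exact: ler0n.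
by rewrite big_seq sumr_ge0 // => e eq; rewrite mulr_ge0 // (p0 q).
Qed.

Lemma after_edges1_ge0 X w (x : nd X) a : nonneg_weights X -> 0 <= w ->
  {in after_edges1 w x a, forall e, 0 <= e.1}.
Proof.
move=> X0 w0; rewrite /after_edges1; case: step => [[y|q]|] // e.
  by rewrite inE => /eqP ->.
by case/mapP => f fq -> /=; rewrite mulr_ge0 // (X0 q).
Qed.

Lemma nonneg_weights_after p M a :
  nonneg_weights (sys p) -> nonneg_weights (sys (after p M a)).
Proof.
move=> p0; rewrite /after; case: (init p) => [x|q]; first by case: step.
case=> [q'|] /=; first exact: p0.
move=> e /flattenP[es /mapP[f]]; rewrite mem_filter => /andP[_ fq] ->.
apply: after_edges1_ge0 => //; rewrite divr_ge0 ?(p0 q) //.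
rewrite big_filter big_seq_cond sumr_ge0 // => g /andP[gq _].
exact: (p0 q).
Qed.

(** The normalization in [after] cancels against [menu_prob]. Since [a \in M1], a nondeterministic
    root of menu [M1] can perform [a], so [after] does not fall back on [p]. *)
Lemma trace_mass_after p M1 a l M : nonneg_weights (sys p) -> a \in M1 ->
  trace_mass ((M1, a) :: l) M (start 1 (init p)) =
  menu_prob p M1 * trace_mass l M (start 1 (init (after p M1 a))).
Proof.
move=> p0 aM; rewrite menu_probE /= /after; case: (init p) => [x|q] /=.
  rewrite /cond_edges /= big_mkcond big_seq1 /=.
  case: eqP => [xM|_] /=; last first.
    (* The empty list is its own multiple by 0, hence has mass 0. *)
    have := trace_mass_scale 0 l M ([::] : seq (R * nd (sys p))).
    by rewrite !mul0r.
  rewrite cats0 after_edges1E; move: aM; rewrite -xM inE.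
  by case: step => // y _; rewrite mul1r.
rewrite !scale1 trace_mass_adjoin after_edges_scale trace_mass_scale mulrA.
set m := \sum_(e <- _ | _) _; have [m0|m0] := eqVneq m 0; last first.
  by rewrite divff // mul1r.
(* Nonnegative weights with sum 0 all vanish, so this list is its own multiple by 0 and both sides
   are 0. *)
suff -> : cond_edges (dist q) M1 a = scale 0 (cond_edges (dist q) M1 a).
  by rewrite trace_mass_scale m0 !mul0r.
rewrite {2}/cond_edges /scale map_flatten -map_comp.
congr flatten; apply/eq_in_map => e; rewrite mem_filter => /andP[eM eq] /=.
rewrite -[LHS]scale1 -/(scale 0 _) -!after_edges1_scale mul0r mul1r.
congr after_edges1; move/eqP: m0.
rewrite /m big_seq_cond psumr_eq0 => [/allP/(_ e eq)|f /andP[fq _]].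
  by rewrite eq eM => /eqP.
exact: (p0 q).
Qed.

Lemma ready_trace_equiv_mass p p' l M :
  nonneg_weights (sys p) -> nonneg_weights (sys p') ->
  (forall Ma, Ma \in l -> Ma.2 \in Ma.1) -> ready_trace_equiv p p' ->
  trace_mass l M (start 1 (init p)) = trace_mass l M (start 1 (init p')).
Proof.
move=> + + + pp'; have menu_eq M' : menu_prob p M' = menu_prob p' M'.
  have mem0 Ma : Ma \in ([::] : seq ({set Act} * Act)) -> Ma.2 \in Ma.1 by [].
  by case: (pp' [::] M' mem0).
elim: l p p' pp' menu_eq => [|[M1 a] l IHl] p p' pp' menu_eq p0 p'0 lM.
  by rewrite -!menu_probE.
have aM : a \in M1 by apply: (lM (M1, a)); rewrite mem_head.
have {}lM Ma : Ma \in l -> Ma.2 \in Ma.1.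
  by move=> Mal; apply: lM; rewrite inE Mal orbT.
rewrite !trace_mass_after // -menu_eq.
(* If [M1] has probability 0, the later conditional probabilities are undefined, but the factor 0
   kills both masses. Otherwise the conditioned processes inherit the equivalence. *)
have := menu_prob_ge0 M1 p0; rewrite le_eqVlt => /predU1P[<-|pM].
  by rewrite !mul0r.
have after_equiv : ready_trace_equiv (after p M1 a) (after p' M1 a).
  move=> k N kM; have := pp' ((M1, a) :: k) N; rewrite /= -menu_eq pM; apply.
  by move=> Ma; rewrite inE => /predU1P[-> //|]; apply: kM.
congr (_ * _); apply: IHl => //; try exact: nonneg_weights_after.
move=> N; have mem0 Ma : Ma \in ([::] : seq ({set Act} * Act)) -> Ma.2 \in Ma.1.
  by [].
by case: (after_equiv [::] N mem0).
Qed.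

Lemma big_cond_edges X (es : seq (R * nd X)) M a (F : R * nd X -> R) :
  \sum_(f <- cond_edges es M a) F f =
  \sum_(e <- es | menu e.2 == M) \sum_(f <- after_edges1 e.1 e.2 a) F f.
Proof. by rewrite /cond_edges big_flatten big_map big_filter. Qed.

End WeightedLists.

(** * Expected results of tests on weighted lists *)

Section ExpectedResult.
Variables (R : realType) (Act : finType) (Y : pts_data R (option Act)).
Implicit Types (X : pts_data R Act) (T : state Y) (v : env R Act).
Implicit Types (l : seq ({set Act} * Act)).

Definition mean_res X (es : seq (R * nd X)) T v : R :=
  \sum_(e <- es) e.1 * Res (inl e.2) T v.

Lemma mean_res_start X w (x : state X) T v :
  (forall q : pr X, \sum_(e <- dist q) e.1 = 1) -> finite_process T ->
  mean_res (start w x) T v = w * Res x T v.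
Proof.
move=> X1 fT; case: x => [x|q]; rewrite /mean_res /=; first by rewrite big_seq1.
rewrite big_map [in RHS]ResE // /res_body.
case: ifP => [oT|_]; last first.
  by rewrite mulr_sumr; apply: eq_bigr => e _; rewrite mulrA.
(* Here the test succeeds before [q] is resolved: [Res] is 1 at [q] and at each successor, and total
   mass 1 reconciles the two. *)
rewrite -(X1 q) mulr_sumr; apply: eq_bigr => e _ /=.
by rewrite ResE // /res_body oT mulr1.
Qed.

(** Every entry has result 1, which leaves the total mass; grouping by menu expresses it through
    traces of length one. *)
Lemma mean_res_omega X (es : seq (R * nd X)) T v :
  finite_process T -> has_omega T ->
  mean_res es T v = \sum_(M : {set Act}) trace_mass [::] M es.
Proof.
move=> fT oT; rewrite /mean_res (partition_big (fun e => menu e.2) xpredT) //=.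
apply: eq_bigr => M _; apply: eq_bigr => e _.
by rewrite ResE // /res_body oT mulr1.
Qed.

(** The entries are nondeterministic, so [Res] resolves the choice of the test next, and the two
    finite sums commute. *)
Lemma mean_res_dist X (es : seq (R * nd X)) (q : pr Y) v :
  finite_process (inr q : state Y) ->
  mean_res es (inr q) v = \sum_(e <- dist q) e.1 * mean_res es (inl e.2) v.
Proof.
move=> fq; rewrite /mean_res; under [RHS]eq_bigr do rewrite mulr_sumr.
rewrite exchange_big; apply: eq_bigr => e _ /=.
rewrite ResE // /res_body /= mulr_sumr.
by apply: eq_bigr => f _; rewrite mulrCA.
Qed.

(** Entries with the same menu share with [y] the same actions, so the coefficients leave the sum
    over these entries. *)
Lemma mean_res_step X (es : seq (R * nd X)) (y : nd Y) v :
  (forall q : pr X, \sum_(e <- dist q) e.1 = 1) ->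
  finite_process (inl y : state Y) -> ~~ has_omega (inl y : state Y) ->
  mean_res es (inl y) v =
  \sum_(M : {set Act}) \sum_(a in [set a in M | Some a \in menu y])
    (v a)%:num / (\sum_(b in [set b in M | Some b \in menu y]) (v b)%:num) *
    (if step y (Some a) is Some T then mean_res (cond_edges es M a) T v else 0).
Proof.
move=> X1 fy oy; rewrite /mean_res.
rewrite (partition_big (fun e => menu e.2) xpredT) //=; apply: eq_bigr => M _.
set K := [set a in M | _].
(* The contribution of [e] after [a]; the weight [e.1] is already inside [after_edges1]. *)
pose G a (e : R * nd X) := if step y (Some a) is Some T
  then mean_res (after_edges1 e.1 e.2 a) T v else 0.
transitivity (\sum_(e <- es | menu e.2 == M) \sum_(a in K)
    (v a)%:num / (\sum_(b in K) (v b)%:num) * G a e).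
  apply: eq_bigr => e /eqP eM.
  rewrite ResE // /res_body (negPf oy) eM -/K mulr_sumr.
  apply: eq_bigr => a aK; rewrite mulrCA; congr (_ * _); rewrite /G.
  have sT T : step y (Some a) = Some T -> finite_process T.
    move=> yT; apply: finite_process_succ fy.
    by apply/existsP; exists (Some a); rewrite yT.
  rewrite after_edges1E; case: (step y (Some a)) sT => [T|] sT.
    have {}sT := sT T erefl.
    case: step => [x|]; first by rewrite mean_res_start.
    by rewrite mulr0 /mean_res big_nil.
  by case: step => [x|]; rewrite mulr0.
rewrite exchange_big; apply: eq_bigr => a _ /=; rewrite -mulr_sumr.
congr (_ * _); rewrite /G; case: step => [T|]; last by rewrite big1.
by rewrite big_cond_edges.
Qed.

(** The bound on run lengths drops along every transition; at bound 0 there is no successor. *)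
Lemma finite_process_ind (A : finType) (Z : pts_data R A) (P : state Z -> Prop) :
  (forall x, finite_process x -> (forall y, succ x y -> P y) -> P x) ->
  forall x, finite_process x -> P x.
Proof.
move=> IHP x fx; case: (fx) => n; elim: n x fx => [|n IHn] x fx nx.
  by apply: IHP => // y xy; have := nx [:: y]; rewrite /= xy => /(_ isT).
apply: IHP => // y xy; apply: IHn => [|r yr].
  exact: finite_process_succ xy fx.
by apply: (nx (y :: r)); rewrite /= xy.
Qed.

(** The lists are quantified after the test because, in the induction on it, an action replaces them
    by conditioned lists. *)
Lemma mean_res_eq X X' T v :
  (forall q : pr X, \sum_(e <- dist q) e.1 = 1) ->
  (forall q : pr X', \sum_(e <- dist q) e.1 = 1) ->
  finite_process T ->
  forall (es : seq (R * nd X)) (es' : seq (R * nd X')),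
    (forall l M, (forall Ma, Ma \in l -> Ma.2 \in Ma.1) ->
      trace_mass l M es = trace_mass l M es') ->
    mean_res es T v = mean_res es' T v.
Proof.
move=> X1 X'1; move: T; apply: finite_process_ind => T fT IHT es es' ees'.
have [oT|oT] := boolP (has_omega T).
  rewrite !mean_res_omega //; apply: eq_bigr => M _; exact: ees'.
case: T fT IHT oT => [y|q] fT IHT oT; last first.
  rewrite !mean_res_dist // big_seq [RHS]big_seq; apply: eq_bigr => e eq.
  by congr (_ * _); apply: IHT => //=; apply: map_f.
rewrite !mean_res_step //; apply: eq_bigr => M _; apply: eq_bigr => a.
rewrite inE => /andP[aM _]; congr (_ * _).
case yT: (step y (Some a)) => [T|//]; apply: IHT.
  by apply/existsP; exists (Some a); rewrite yT.
(* Masses of the conditioned lists along [l] are those of the original lists along [(M, a) :: l], a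
   legal trace as [a \in M]. *)
move=> l N lN; apply: (ees' ((M, a) :: l)) => Ma.
by rewrite inE => /predU1P[->|/lN].
Qed.

End ExpectedResult.

Theorem theorem4 (R : realType) (Act : finType) (s t : process R Act)
    (hs : is_pts (sys s)) (ht : is_pts (sys t)) :
  ready_trace_equiv s t -> testing_equiv s t.
Proof.
have nonneg X : is_pts X -> @nonneg_weights R Act X.
  by move=> hX q e eq; have [_ /(_ e eq)/andP[/ltW]] := hX q.
have sum1 (X : pts_data R Act) : is_pts X ->
    forall q : pr X, \sum_(e <- dist q) e.1 = 1.
  by move=> hX q; have [] := hX q.
move=> st T _ fT v.
(* The factor 1 exhibits each [Res] as the mean result of a starting list of weight 1. *)
rewrite -[LHS]mul1r -[RHS]mul1r -!mean_res_start //; try exact: sum1.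
apply: mean_res_eq => //; try exact: sum1.
by move=> l M lM; apply: ready_trace_equiv_mass => //; exact: nonneg.
Qed.
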